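(* There exist finite graphs $G$ that are not $\mathbf{W_2}$ such that, for every vertex $v$ in $G$ and every maximal independent set $S$ in $G - N[v]$, the largest independent set in $N(v) \setminus N(S)$ consists of a single vertex (that is, the maximum size of an independent set of $G$ contained in $N(v)\setminus N(S)$ is exactly $1$).
   Context: Graphs are finite, simple and undirected. An independent set of a graph is a set of pairwise non-adjacent vertices (possibly empty); it is maximum if it has the largest size among all independent sets of the graph, and maximal if it is not a proper subset of any other independent set. A graph $G$ is $\mathbf{W_2}$ if for any two disjoint independent vertex subsets $A_1, A_2$ in $G$, there exist two disjoint maximum independent sets $S_1, S_2$ in $G$ such that $A_1 \subseteq S_1$ and $A_2 \subseteq S_2$. For a vertex $v$, $N(v)$ is the set of neighbours of $v$ in $G$ and $N[v] = N(v)\cup\{v\}$; $G - N[v]$ is the graph obtained from $G$ by deleting the vertices of $N[v]$ (if it has no vertices, its only maximal independent set is $\emptyset$). For a set $S$ of vertices, $N(S)$ is the set of vertices of $G$ having a neighbour in $S$ (so $N(\emptyset)=\emptyset$). *)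

(* Defs.v *)
From mathcomp Require Import all_boot.

Set Implicit Arguments.
Unset Strict Implicit.
Unset Printing Implicit Defensive.

(* A finite simple undirected graph is a finType V with a symmetric and
   irreflexive relation e : rel V. *)

Definition simple_graph (V : finType) (e : rel V) : Prop :=
  symmetric e /\ irreflexive e.

Definition independent (V : finType) (e : rel V) (A : {set V}) : bool :=
  [forall x in A, forall y in A, ~~ e x y].

(* The induced subgraph on W is represented by its vertex set W: an independent
   set of that subgraph is an independent set of the graph contained in W. *)

Definition independent_in (V : finType) (e : rel V) (W A : {set V}) : bool :=
  (A \subset W) && independent e A.

Definition independence_number (V : finType) (e : rel V) (W : {set V}) : nat :=
  \max_(A : {set V} | independent_in e W A) #|A|.

Definition maximal_independent_in (V : finType) (e : rel V) (W S : {set V}) :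
    bool :=
  maxset (independent_in e W) S.

Definition maximum_independent (V : finType) (e : rel V) (S : {set V}) : bool :=
  independent e S && (#|S| == independence_number e [set: V]).

Definition W2 (V : finType) (e : rel V) : Prop :=
  forall A1 A2 : {set V},
    independent e A1 -> independent e A2 -> [disjoint A1 & A2] ->
    exists S1 S2 : {set V},
      [/\ maximum_independent e S1, maximum_independent e S2,
          [disjoint S1 & S2], A1 \subset S1 & A2 \subset S2].

Definition neighbours (V : finType) (e : rel V) (v : V) : {set V} :=
  [set u | e v u].

Definition closed_neighbours (V : finType) (e : rel V) (v : V) : {set V} :=
  v |: neighbours e v.

Definition set_neighbours (V : finType) (e : rel V) (S : {set V}) : {set V} :=
  [set u | [exists s in S, e u s]].

(* Main.v *)
Require Import Defs.
From mathcomp Require Import all_boot.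

Set Implicit Arguments.
Unset Strict Implicit.
Unset Printing Implicit Defensive.

(** The example is the join of [2 K_2] and [3 K_2]: two disjoint edges and three
disjoint edges, with all edges added between the two parts.

An independent set lies in one part and uses at most one endpoint of each of its
edges, so maximal independent sets have two vertices in one part and three in
the other.  Hence no maximum independent set contains a vertex of the part
[2 K_2], which contradicts [W2] ([join_not_W2]).

The neighbourhood condition only sees one part at a time.  If [S] is maximal
independent in [G - N[v]], then [S] lies in the part of [v] and avoids the edge
of [v].  It is nonempty because the part of [v] has another edge, so every
vertex of the opposite part is in [N(S)], and all that is left of [N(v)] is the
other endpoint of the edge of [v] ([private_neighbours_partner]).

In terms of the independence complex, exchanging one vertex of a facet at a time
never leaves a connected component, so the condition cannot compare two
components of different dimensions. *)

(** The vertices [(i, false)] and [(i, true)] are the endpoints of the [i]-th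
edge; edges 0 and 1 form the first part, edges 2, 3 and 4 the second. *)
Definition vertex : finType := ('I_5 * bool)%type.

Definition in_first_part (x : vertex) : bool := x.1 < 2.

Definition join_edge : rel vertex := fun x y =>
  (in_first_part x != in_first_part y) || ((x.1 == y.1) && (x.2 != y.2)).

Definition partner (x : vertex) : vertex := (x.1, ~~ x.2).

Lemma join_simple : simple_graph join_edge.
Proof.
split=> [x y|x]; rewrite /join_edge; last by rewrite !eqxx.
by rewrite [in_first_part x == _]eq_sym [x.1 == _]eq_sym [x.2 == _]eq_sym.
Qed.

Lemma independent1 (V : finType) (e : rel V) (x : V) :
  irreflexive e -> independent e [set x].
Proof.
move=> e_irr; apply/'forall_implyP => y /set1P->.
by apply/'forall_implyP => z /set1P->; rewrite e_irr.
Qed.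

Lemma independence_number1 (V : finType) (e : rel V) (x : V) :
  irreflexive e -> independence_number e [set x] = 1.
Proof.
move=> e_irr; apply/eqP; rewrite eqn_leq; apply/andP; split.
  apply/bigmax_leqP => A /andP[/subset_leq_card sAx _].
  by rewrite cards1 in sAx.
rewrite -[X in X <= _](cards1 x).
by apply: leq_bigmax_cond; rewrite /independent_in subxx independent1.
Qed.

Lemma not_closed_neighboursE (v x : vertex) :
  (x \in ~: closed_neighbours join_edge v) =
  (in_first_part x == in_first_part v) && (x.1 != v.1).
Proof.
case: v x => [i b] [j c]; rewrite !inE /join_edge /= xpair_eqE [i == j]eq_sym.
rewrite /in_first_part /= [(i < 2) == _]eq_sym.
by case: eqP => [->|_]; case: (boolP (_ == _ :> bool)) => //=; case: b; case: c;
   rewrite ?eqxx.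
Qed.

(** Both parts have at least two edges; this is what rules out [S = set0]. *)
Lemma exists_other_edge (v : vertex) :
  exists w, w \in ~: closed_neighbours join_edge v.
Proof.
suff [j Pj] : exists j : 'I_5, ((j < 2) == (v.1 < 2)) && (j != v.1).
  by exists (j, true); rewrite not_closed_neighboursE.
case: v => [[i lti] b] /=.
move: i lti => [|[|[|[|[|//]]]]] lti.
- by exists (inord 1); rewrite -val_eqE /= inordK.
- by exists (inord 0); rewrite -val_eqE /= inordK.
- by exists (inord 3); rewrite -val_eqE /= inordK.
- by exists (inord 2); rewrite -val_eqE /= inordK.
- by exists (inord 2); rewrite -val_eqE /= inordK.
Qed.

Lemma maximal_independent_in_neq0 (V : finType) (e : rel V) (W S : {set V})
    (w : V) :
  irreflexive e -> w \in W -> maximal_independent_in e W S -> S != set0.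
Proof.
move=> e_irr wW /maxsetP[_ Smax]; apply/eqP => S0.
have := Smax [set w]; rewrite S0 sub0set /independent_in sub1set wW.
by rewrite independent1 // => /(_ isT isT)/setP/(_ w); rewrite !inE eqxx.
Qed.

Lemma private_neighbours_partner (v : vertex) (S : {set vertex}) :
  maximal_independent_in join_edge (~: closed_neighbours join_edge v) S ->
  neighbours join_edge v :\: set_neighbours join_edge S = [set partner v].
Proof.
move=> Smax; have [_ e_irr] := join_simple.
have [w ww] := exists_other_edge v.
have /set0Pn[s sS] := maximal_independent_in_neq0 e_irr ww Smax.
have [/andP[/subsetP SW _] _] := maxsetP Smax.
apply/setP => u; rewrite !inE; apply/andP/eqP => [[uNS evu]|->]; last first.
  split; last by rewrite /join_edge /= eqxx; case: v.2; rewrite orbT.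
  apply/exists_inP => -[t /SW]; rewrite not_closed_neighboursE.
  case/andP=> [/eqP part_t t_v]; rewrite /join_edge part_t /= eqxx /=.
  by rewrite eq_sym (negPf t_v).
have := SW s sS; rewrite not_closed_neighboursE => /andP[/eqP part_s _].
move: evu; rewrite /join_edge; case/orP => [parts_vu|].
  case/negP: uNS; apply/exists_inP; exists s => //.
  by rewrite /join_edge part_s eq_sym parts_vu.
case: u v {Smax ww SW uNS part_s} => [j c] [i b] /= /andP[/eqP<-].
by rewrite /partner /=; case: b; case: c.
Qed.

(** One endpoint of each edge of the second part. *)
Lemma independence_number_join_ge3 :
  2 < independence_number join_edge [set: vertex].
Proof.
pose T : {set vertex} := [set (i, true) | i : 'I_5 & 2 <= i].
have cardT : #|T| = 3.
  rewrite card_in_imset; last by move=> i j _ _ [].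
  by rewrite -sum1dep_card big_mkcond !big_ord_recl big_ord0.
rewrite -cardT; apply: leq_bigmax_cond; rewrite /independent_in subsetT /=.
apply/'forall_implyP => x /imsetP[i]; rewrite inE => i2 ->.
apply/'forall_implyP => y /imsetP[j]; rewrite inE => j2 ->.
by rewrite /join_edge /in_first_part /= (ltnNge i 2) (ltnNge j 2) i2 j2 andbF.
Qed.

(** Projecting to edge indices is injective on an independent set, and one that
meets the first part has only two indices available. *)
Lemma independent_first_part_le2 (S : {set vertex}) (x : vertex) :
  in_first_part x -> x \in S -> independent join_edge S -> #|S| <= 2.
Proof.
move=> part_x xS /'forall_implyP indep.
have nadj y z : y \in S -> z \in S -> ~~ join_edge y z.
  by move=> /indep/'forall_implyP; apply.
have inj_edge : {in S &, injective (fun y : vertex => y.1)}.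
  move=> [i b] [j c] yS zS /= eq_ij; subst j.
  have := nadj _ _ yS zS.
  by rewrite /join_edge /= !eqxx /= negbK => /eqP->.
rewrite -(card_in_imset inj_edge).
have card2 : #|[set i : 'I_5 | i < 2]| = 2.
  by rewrite -sum1dep_card big_mkcond !big_ord_recl big_ord0.
rewrite -[X in _ <= X]card2; apply/subset_leq_card/subsetP => _ /imsetP[y yS ->].
have := nadj _ _ xS yS; rewrite inE /join_edge part_x negb_or negbK.
by case/andP=> [/eqP part_y _]; exact: esym part_y.
Qed.

Lemma join_not_W2 : ~ W2 join_edge.
Proof.
move=> W2e; have [_ e_irr] := join_simple.
pose x : vertex := (ord0, true).
have indep0 : independent join_edge set0.
  by apply/'forall_implyP => y; rewrite inE.
have [|S1 [S2 [/andP[indS1 /eqP cardS1] _ _ sxS1 _]]] :=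
  W2e [set x] set0 (independent1 x e_irr) indep0.
  by rewrite disjoint_sym disjoints_subset sub0set.
have := independence_number_join_ge3; rewrite -cardS1 ltnNge => /negP; apply.
by apply: (@independent_first_part_le2 _ x); rewrite // -sub1set.
Qed.

Theorem mainTheorem4 :
  exists (V : finType) (e : rel V),
    [/\ simple_graph e,
        ~ W2 e
      & forall (v : V) (S : {set V}),
          maximal_independent_in e (~: closed_neighbours e v) S ->
          independence_number e (neighbours e v :\: set_neighbours e S) = 1].
Proof.
exists vertex, join_edge; split; [exact: join_simple | exact: join_not_W2 |].
move=> v S Smax; rewrite (private_neighbours_partner Smax).
by apply: independence_number1; have [] := join_simple.
Qed.
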